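(* Let $A=(a_{ij})_{m\times n}$ have entries in $[0,1]$, let $b=(b_i)_{m\times 1}$ have entries in $[0,1]$, and let $\lambda>0$. Let $S$ be the solution set of the max-Dombi fuzzy relational system $A\varphi x=b$, and let $\underline{S}$ be the set of all minimal elements of $S$. With $E$, $\bar{E}$ and $\underline{X}(e)$ as defined in the context, $$\underline{S}\subseteq\{\underline{X}(e) : e\in\bar{E}\}\subseteq\{\underline{X}(e) : e\in E\}.$$
   Context: Let $I=\{1,\dots,m\}$, $J=\{1,\dots,n\}$. For $\lambda>0$ the Dombi t-norm $\varphi:[0,1]^2\to[0,1]$ is $\varphi(x,y)=0$ if $x=0$ or $y=0$, and otherwise $$\varphi(x,y)=\left(1+\left[\left(\tfrac{1-x}{x}\right)^{\lambda}+\left(\tfrac{1-y}{y}\right)^{\lambda}\right]^{1/\lambda}\right)^{-1}.$$ For $x\in[0,1]^n$, the system $A\varphi x=b$ means $\max_{j\in J}\varphi(a_{ij},x_j)=b_i$ for all $i\in I$. Put $S=\{x\in[0,1]^n : A\varphi x=b\}$. Vectors are ordered componentwise; $\underline{S}$ is the set of minimal elements of $S$ (those $x\in S$ such that $y\in S$, $y\le x$ imply $y=x$). For $i\in I$ let $J_i=\{j\in J : a_{ij}\ge b_i\}$. For $i\in I$ with $b_i\neq 0$ and $j\in J_i$ let $$V(b_i,a_{ij})=\left(1+\left[\left(\tfrac{1-b_i}{b_i}\right)^{\lambda}-\left(\tfrac{1-a_{ij}}{a_{ij}}\right)^{\lambda}\right]^{1/\lambda}\right)^{-1}.$$ For $i\in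 I$ and $j\in J_i$ define $\breve{x}_i(j)\in[0,1]^n$ by $\breve{x}_i(j)_k=V(b_i,a_{ik})$ if $b_i\neq 0$ and $k=j$, and $\breve{x}_i(j)_k=0$ otherwise ($k\in J$). $E$ is the set of all functions $e:I\to\bigcup_{i\in I}J_i$ with $e(i)\in J_i$ for all $i\in I$. For $e\in E$ define $\underline{X}(e)\in[0,1]^n$ by $\underline{X}(e)_j=\max_{i\in I}\breve{x}_i(e(i))_j$ for $j\in J$. The matrix $\bar{A}=(\bar{a}_{ij})_{m\times n}$ is obtained from $A$ by setting $\bar{a}_{ij}=0$ whenever one of the following holds, and $\bar{a}_{ij}=a_{ij}$ otherwise: (I) $j\notin J_i$; (II) $j\in J_i$, $b_i\neq 0$, and there is $i'\in I$, $i'\neq i$, with $j\in J_{i'}$, $b_{i'}\neq 0$ and $V(b_{i'},a_{i'j})<V(b_i,a_{ij})$; (III) $j\in J_i$, $b_i\neq 0$, and there is $i'\in I$, $i'\neq i$, with $b_{i'}=0$ and $a_{i'j}>0$. Let $\bar{J}_i=\{j\in J : \bar{a}_{ij}\ge b_i\}$, and let $\bar{E}$ be the set of all functions $e:I\to\bigcup_{i\in I}\bar{J}_i$ with $e(i)\in\bar{J}_i$ for all $i\in I$. (One has $\bar{J}_i\subseteq J_i$, so $\underline{X}(e)$ is defined for $e\in\bar{E}$ by the same formula.) *)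

(* Defs.v *)
From mathcomp Require Import all_boot all_order all_algebra.
From mathcomp Require Import all_classical all_reals all_analysis.

Set Implicit Arguments.
Unset Strict Implicit.
Unset Printing Implicit Defensive.

Import Order.TTheory GRing.Theory Num.Theory.

Local Open Scope classical_set_scope.
Local Open Scope ring_scope.

Definition dombi (R : realType) (lam x y : R) : R :=
  if (x == 0) || (y == 0) then 0
  else (1 + (((1 - x) / x) `^ lam + ((1 - y) / y) `^ lam) `^ (lam^-1))^-1.

(* The values of dombi on [0,1]^2 are nonnegative, so the default value 0 of
   the big maximum is harmless as soon as 0 < n. *)
Definition max_dombi (R : realType) (m n : nat) (lam : R)
    (A : 'M[R]_(m, n)) (x : 'cV[R]_n) : 'cV[R]_m :=
  \col_i \big[Num.max/0]_(j < n) dombi lam (A i j) (x j 0).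

Definition solutions (R : realType) (m n : nat) (lam : R)
    (A : 'M[R]_(m, n)) (b : 'cV[R]_m) : set 'cV[R]_n :=
  [set x : 'cV[R]_n | (forall j, 0 <= x j 0 <= 1) /\ max_dombi lam A x = b].

Definition minimal_elements (R : realType) (n : nat) (S : set 'cV[R]_n) :
    set 'cV[R]_n :=
  [set x : 'cV[R]_n | S x /\
    forall y : 'cV[R]_n, S y -> (forall j, y j 0 <= x j 0) -> y = x].

Definition Jset (R : realType) (m n : nat)
    (A : 'M[R]_(m, n)) (b : 'cV[R]_m) (i : 'I_m) : {set 'I_n} :=
  [set j : 'I_n | b i 0 <= A i j]%SET.

(* Only meaningful (and only used) for 0 < bi <= a <= 1, where the base of the
   outer power is nonnegative; elsewhere its value is junk. *)
Definition V (R : realType) (lam bi a : R) : R :=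
  (1 + (((1 - bi) / bi) `^ lam - ((1 - a) / a) `^ lam) `^ (lam^-1))^-1.

Definition xbreve (R : realType) (m n : nat) (lam : R)
    (A : 'M[R]_(m, n)) (b : 'cV[R]_m) (i : 'I_m) (j : 'I_n) : 'cV[R]_n :=
  \col_k (if (b i 0 != 0) && (k == j) then V lam (b i 0) (A i k) else 0).

(* A map e : I -> \bigcup_i J_i with e i \in J_i for all i is the same thing as
   a map e : I -> J with e i \in J_i for all i. *)
Definition Eset (R : realType) (m n : nat)
    (A : 'M[R]_(m, n)) (b : 'cV[R]_m) : set {ffun 'I_m -> 'I_n} :=
  [set e : {ffun 'I_m -> 'I_n} | forall i, e i \in Jset A b i].

Definition Xlow (R : realType) (m n : nat) (lam : R)
    (A : 'M[R]_(m, n)) (b : 'cV[R]_m) (e : {ffun 'I_m -> 'I_n}) : 'cV[R]_n :=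
  \col_j \big[Num.max/0]_(i < m) xbreve lam A b i (e i) j 0.

Definition reset2 (R : realType) (m n : nat) (lam : R)
    (A : 'M[R]_(m, n)) (b : 'cV[R]_m) (i : 'I_m) (j : 'I_n) : bool :=
  [&& j \in Jset A b i, b i 0 != 0 &
    [exists i', [&& i' != i, j \in Jset A b i', b i' 0 != 0 &
      V lam (b i' 0) (A i' j) < V lam (b i 0) (A i j)]]].

Definition reset3 (R : realType) (m n : nat)
    (A : 'M[R]_(m, n)) (b : 'cV[R]_m) (i : 'I_m) (j : 'I_n) : bool :=
  [&& j \in Jset A b i, b i 0 != 0 &
    [exists i', [&& i' != i, b i' 0 == 0 & 0 < A i' j]]].

Definition Abar (R : realType) (m n : nat) (lam : R)
    (A : 'M[R]_(m, n)) (b : 'cV[R]_m) : 'M[R]_(m, n) :=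
  \matrix_(i, j)
    (if [|| j \notin Jset A b i, reset2 lam A b i j | reset3 A b i j]
     then 0 else A i j).

Definition Ebar (R : realType) (m n : nat) (lam : R)
    (A : 'M[R]_(m, n)) (b : 'cV[R]_m) : set {ffun 'I_m -> 'I_n} :=
  Eset (Abar lam A b) b.

(* Main.v *)
(* For a > 0 the map dombi a is strictly increasing, so dombi a x = c with c != 0
   forces c <= a and x = V c a.  Given a solution x, choose for each row with
   nonzero right-hand side a column e i attaining the maximum; then
   x (e i) = V (b i) (A i (e i)).  Hence Xlow e lies below x and agrees with x at
   every column e i, so it is a solution by monotonicity, and it equals x when
   x is minimal. *)
Require Import Defs.
From mathcomp Require Import all_boot all_order all_algebra.
From mathcomp Require Import all_classical all_reals all_analysis.

Set Implicit Arguments.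
Unset Strict Implicit.
Unset Printing Implicit Defensive.

Import Order.TTheory GRing.Theory Num.Theory.

Local Open Scope classical_set_scope.
Local Open Scope ring_scope.

Lemma powRK (R : realType) (r u : R) (hr : r != 0) (hu : 0 <= u) :
  (u `^ r) `^ r^-1 = u.
Proof. by rewrite -powRrM divff// powRr1. Qed.

Lemma powRVK (R : realType) (r u : R) (hr : r != 0) (hu : 0 <= u) :
  (u `^ r^-1) `^ r = u.
Proof. by rewrite -powRrM mulVf// powRr1. Qed.

Lemma odds_ge0 (R : realType) (u : R) (hu : 0 <= u <= 1) : 0 <= (1 - u) / u.
Proof. by case/andP: hu => u0 u1; rewrite divr_ge0// subr_ge0. Qed.

Lemma oddsE (R : realType) (u : R) (hu : u != 0) : (1 - u) / u = u^-1 - 1.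
Proof. by rewrite mulrBl mul1r divff. Qed.

Lemma powR_odds_lt (R : realType) (lam u v : R) (hlam : 0 < lam)
    (u0 : 0 < u) (uv : u < v) (v1 : v <= 1) :
  ((1 - v) / v) `^ lam < ((1 - u) / u) `^ lam.
Proof.
have v0 : 0 < v by exact: lt_trans uv.
apply: gt0_ltr_powR => //.
- by rewrite nnegrE odds_ge0// v1 ltW.
- by rewrite nnegrE odds_ge0// (ltW u0) (le_trans (ltW uv)).
- by rewrite !oddsE ?gt_eqF// ltrD2r ltf_pV2.
Qed.

Lemma dombi0r (R : realType) (lam a : R) : dombi lam a 0 = 0.
Proof. by rewrite /dombi eqxx orbT. Qed.

Lemma dombi0l (R : realType) (lam x : R) : dombi lam 0 x = 0.
Proof. by rewrite /dombi eqxx. Qed.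

Lemma dombi_ge0 (R : realType) (lam a x : R) : 0 <= dombi lam a x.
Proof.
by rewrite /dombi; case: ifP => // _; rewrite invr_ge0 addr_ge0 ?powR_ge0.
Qed.

Lemma dombi_gt0 (R : realType) (lam a x : R) (a0 : 0 < a) (x0 : 0 < x) :
  0 < dombi lam a x.
Proof.
by rewrite /dombi !gt_eqF//= invr_gt0 ltr_wpDr ?powR_ge0.
Qed.

(** The odds [(1 - x) / x] strictly decrease in [x], positive powers preserve the order, and the
    final inverse reverses it again. The case [x = 0] is separate because [dombi] is defined there
    by a case split. *)
Lemma dombi_lt (R : realType) (lam a x y : R) (hlam : 0 < lam)
    (a0 : 0 < a) (x0 : 0 <= x) (xy : x < y) (y1 : y <= 1) :
  dombi lam a x < dombi lam a y.
Proof.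
have y0 : 0 < y by exact: le_lt_trans xy.
move: x0; rewrite le_eqVlt => /predU1P[<-|x0].
  by rewrite dombi0r dombi_gt0.
have dpos z : 0 < 1 + (((1 - a) / a) `^ lam + z) `^ lam^-1.
  by rewrite ltr_wpDr ?powR_ge0.
rewrite /dombi !gt_eqF//= ltf_pV2 ?posrE ?dpos//.
rewrite ltrD2l; apply: gt0_ltr_powR; rewrite ?invr_gt0//.
- by rewrite nnegrE addr_ge0 ?powR_ge0.
- by rewrite nnegrE addr_ge0 ?powR_ge0.
- by rewrite ltrD2l powR_odds_lt.
Qed.

Lemma dombi_le (R : realType) (lam a x y : R) (hlam : 0 < lam)
    (a0 : 0 <= a) (x0 : 0 <= x) (xy : x <= y) (y1 : y <= 1) :
  dombi lam a x <= dombi lam a y.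
Proof.
move: a0; rewrite le_eqVlt => /predU1P[<-|a0]; first by rewrite !dombi0l.
move: xy; rewrite le_eqVlt => /predU1P[->//|xy].
exact/ltW/dombi_lt.
Qed.

(** The odds of 1 vanish, so the outer power undoes the inner one. With monotonicity this bounds
    [dombi lam a x] by [a]. *)
Lemma dombir1 (R : realType) (lam a : R) (hlam : 0 < lam) (ha : 0 <= a <= 1) :
  dombi lam a 1 = a.
Proof.
rewrite /dombi oner_eq0 orbF; case: ifPn => [/eqP->//|a_neq0].
rewrite subrr mul0r powR0 ?gt_eqF// addr0 powRK ?gt_eqF ?odds_ge0//.
by rewrite oddsE// subrKC invrK.
Qed.

(** The inequality compares [x] with 1. For the equation, [c != 0] excludes the zero branch of
    [dombi]; then [c^-1 - 1] is the outer power, and solving for the odds of [x] yields [V]. *)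
Lemma dombi_leV (R : realType) (lam a x c : R) (hlam : 0 < lam)
    (ha : 0 <= a <= 1) (hx : 0 <= x <= 1) (c0 : c != 0)
    (axc : dombi lam a x = c) :
  c <= a /\ x = V lam c a.
Proof.
have /andP[a0 a1] := ha; have /andP[x0 x1] := hx.
split.
  have := dombi_le hlam a0 x0 x1 (lexx 1).
  by rewrite dombir1// axc.
have lam0 : lam != 0 by rewrite gt_eqF.
move: axc; rewrite /dombi.
case: ifPn => [_ /esym/eqP|]; first by rewrite (negbTE c0).
rewrite negb_or => /andP[a_neq0 x_neq0] axc.
rewrite /V [(1 - c) / c]oddsE// -{}axc invrK [1 + _ - 1]addrAC subrr add0r.
rewrite powRVK ?addr_ge0 ?powR_ge0// [_ + _ - _]addrAC subrr add0r.
by rewrite powRK ?odds_ge0// oddsE// subrKC invrK.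
Qed.

Lemma V_gt0 (R : realType) (lam c a : R) : 0 < V lam c a.
Proof. by rewrite /V invr_gt0 ltr_wpDr ?powR_ge0. Qed.

(** Converse of [dombi_leV]: the candidate [V lam c a] really solves the equation. *)
Lemma dombiV (R : realType) (lam a c : R) (hlam : 0 < lam)
    (c0 : 0 < c) (ca : c <= a) (a1 : a <= 1) :
  dombi lam a (V lam c a) = c.
Proof.
have a0 : 0 < a by exact: lt_le_trans ca.
have lam0 : lam != 0 by rewrite gt_eqF.
rewrite /dombi !gt_eqF ?V_gt0//= [(1 - V _ _ _) / _]oddsE ?gt_eqF ?V_gt0//.
rewrite {1}/V invrK [1 + _ - 1]addrAC subrr add0r powRVK//; last first.
  (* The base of the outer power in [V] is nonnegative because [c <= a] orders the odds. *)
  move: ca; rewrite subr_ge0 le_eqVlt => /predU1P[->//|ca].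
  exact/ltW/powR_odds_lt.
rewrite subrKC powRK ?odds_ge0 ?(ltW c0) ?(le_trans ca)//.
by rewrite oddsE ?gt_eqF// subrKC invrK.
Qed.

(** A nonzero maximum cannot be the default value 0, so it comes from some index. *)
Lemma bigmax0_attained (R : realType) (n : nat) (F : 'I_n -> R) :
  \big[Num.max/0]_(j < n) F j != 0 ->
  exists j, F j = \big[Num.max/0]_(j < n) F j.
Proof.
elim/big_rec: _ => [|j c _ IH]; first by rewrite eqxx.
by rewrite /Num.max; case: ifP => // _ _; exists j.
Qed.

Lemma solution_dombi_le (R : realType) (m n : nat) (lam : R)
    (A : 'M[R]_(m, n)) (b : 'cV[R]_m) (x : 'cV[R]_n)
    (i : 'I_m) (j : 'I_n) (Sx : solutions lam A b x) :
  dombi lam (A i j) (x j 0) <= b i 0.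
Proof.
by case: Sx => _ <-; rewrite mxE; exact: (le_bigmax _ (fun _ => _)).
Qed.

Lemma solution_attained (R : realType) (m n : nat) (lam : R)
    (A : 'M[R]_(m, n)) (b : 'cV[R]_m) (x : 'cV[R]_n) (i : 'I_m)
    (Sx : solutions lam A b x) (bi0 : b i 0 != 0) :
  exists j, dombi lam (A i j) (x j 0) = b i 0.
Proof.
by case: Sx bi0 => _ <-; rewrite mxE => /bigmax0_attained.
Qed.

(** Resetting nonnegative entries to 0 only lowers them, so each [Jset] can only shrink. *)
Lemma Eset_Ebar (R : realType) (m n : nat) (lam : R)
    (A : 'M[R]_(m, n)) (b : 'cV[R]_m) (hA : forall i j, 0 <= A i j) :
  Ebar lam A b `<=` Eset A b.
Proof.
move=> e eE i; move: (eE i); rewrite !inE => /le_trans; apply.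
by rewrite mxE; case: ifP.
Qed.

(* By strict monotonicity of [dombi], a row violating (II) or (III) would exceed
   its right-hand side at [x j]. *)
Lemma solution_Abar (R : realType) (m n : nat) (lam : R)
    (A : 'M[R]_(m, n)) (b : 'cV[R]_m) (x : 'cV[R]_n) (i : 'I_m) (j : 'I_n)
    (hA : forall i j, 0 <= A i j <= 1) (hb : forall i, 0 <= b i 0)
    (hlam : 0 < lam) (Sx : solutions lam A b x) (bi0 : b i 0 != 0)
    (ij : dombi lam (A i j) (x j 0) = b i 0) :
  Abar lam A b i j = A i j.
Proof.
have xj := Sx.1 j; have /andP[x0 x1] := xj.
(* [bA] rules out (I). By [xV], condition (II) compares the [V] of another row with [x j 0] itself,
   and in (III) [x j 0] is positive. *)
have [bA xV] := dombi_leV hlam (hA i j) xj bi0 ij.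
rewrite mxE inE bA/=; case: ifPn => // /orP[|].
- move=> /and3P[_ _ /existsP[i' /and4P[_ bA' bi'0]]]; rewrite -xV => Vx.
  move: bA'; rewrite inE => bA'.
  have b'0 : 0 < b i' 0 by rewrite lt_neqAle eq_sym bi'0 hb.
  have /andP[_ A1] := hA i' j.
  have A0 := lt_le_trans b'0 bA'.
  have := dombi_lt hlam A0 (ltW (V_gt0 _ _ _)) Vx x1.
  by rewrite dombiV// ltNge solution_dombi_le.
- move=> /and3P[_ _ /existsP[i' /and3P[_ /eqP bi'0 A0]]].
  have := solution_dombi_le i' j Sx; rewrite bi'0 leNgt dombi_gt0//.
  by rewrite xV V_gt0.
Qed.

Lemma Xlow_solution (R : realType) (m n : nat) (lam : R)
    (A : 'M[R]_(m, n)) (b : 'cV[R]_m) (x : 'cV[R]_n) (e : {ffun 'I_m -> 'I_n})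
    (hA : forall i j, 0 <= A i j <= 1) (hb : forall i, 0 <= b i 0)
    (hlam : 0 < lam) (Sx : solutions lam A b x)
    (he : forall i, b i 0 != 0 -> dombi lam (A i (e i)) (x (e i) 0) = b i 0) :
  solutions lam A b (Xlow lam A b e) /\
  forall j, Xlow lam A b e j 0 <= x j 0.
Proof.
have xV i : b i 0 != 0 -> x (e i) 0 = V lam (b i 0) (A i (e i)).
  move=> bi0.
  by have [] := dombi_leV hlam (hA i (e i)) (Sx.1 (e i)) bi0 (he _ bi0).
have X0 j : 0 <= Xlow lam A b e j 0 by rewrite mxE bigmax_ge_id.
have Xx j : Xlow lam A b e j 0 <= x j 0.
  have /andP[x0 _] := Sx.1 j.
  (* Column [j] receives a nonzero contribution only from rows with [e i = j] and [b i 0 != 0], and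
     each of these contributes exactly [x j 0]. *)
  rewrite mxE; apply: bigmax_le => // i _; rewrite mxE.
  by case: ifPn => // /andP[bi0 /eqP ->]; rewrite -xV.
have Xe i : b i 0 != 0 -> Xlow lam A b e (e i) 0 = x (e i) 0.
  move=> bi0; apply/le_anti; rewrite Xx/= mxE.
  apply: le_trans (le_bigmax _ _ i).
  by rewrite mxE bi0 eqxx -xV.
split; last exact: Xx.
split=> [j|].
  by rewrite X0 (le_trans (Xx j))//; have /andP[] := Sx.1 j.
apply/colP => i; rewrite mxE; apply/le_anti/andP; split.
  apply: bigmax_le => // j _.
  apply: le_trans (solution_dombi_le i j Sx).
  by apply: dombi_le => //; [have /andP[] := hA i j|have /andP[] := Sx.1 j].
have [->|bi0] := eqVneq (b i 0) 0; first exact: bigmax_ge_id.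
rewrite -[leLHS](he _ bi0) -Xe//.
exact: (le_bigmax _ (fun j => dombi lam (A i j) (Xlow lam A b e j 0))).
Qed.

Theorem corollary2 (R : realType) (m n : nat) (lam : R)
    (A : 'M[R]_(m, n)) (b : 'cV[R]_m)
    (hm : (0 < m)%N) (hn : (0 < n)%N)
    (hA : forall i j, 0 <= A i j <= 1)
    (hb : forall i, 0 <= b i 0 <= 1)
    (hlam : 0 < lam) :
  minimal_elements (solutions lam A b) `<=`
    [set Xlow lam A b e | e in Ebar lam A b] /\
  [set Xlow lam A b e | e in Ebar lam A b] `<=`
    [set Xlow lam A b e | e in Eset A b].
Proof.
have A0 i j : 0 <= A i j by case/andP: (hA i j).
have b0 i : 0 <= b i 0 by case/andP: (hb i).
split; last by move=> _ [e eE <-]; exists e => //; exact: Eset_Ebar eE.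
move=> x [Sx minx].
pose p i j := dombi lam (A i j) (x j 0) == b i 0.
(* The default column makes [e] total. Rows with nonzero right-hand side have an attaining column;
   in the other rows any choice will do, since they contribute 0 to [Xlow]. *)
pose e := [ffun i => odflt (Ordinal hn) [pick j | p i j]].
have he i : b i 0 != 0 -> dombi lam (A i (e i)) (x (e i) 0) = b i 0.
  move=> bi0; rewrite ffunE; case: pickP => [j /eqP//|nop].
  by have [j /eqP] := solution_attained Sx bi0; rewrite [_ == _]nop.
have [SX Xx] := Xlow_solution hA b0 hlam Sx he.
exists e; last exact: minx.
(* If [b i 0 = 0], every column is admissible, as the entries of [Abar] are nonnegative. Otherwise
   the attaining entry survives the reset. *)
move=> i; rewrite inE; have [bi0|bi0] := eqVneq (b i 0) 0.
  by rewrite bi0 mxE; case: ifP.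
rewrite (solution_Abar hA b0 hlam Sx bi0 (he _ bi0)).
by have [] := dombi_leV hlam (hA i (e i)) (Sx.1 (e i)) bi0 (he _ bi0).
Qed.
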